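(* Consider the tree dyadic system with parameters $f>0$, $\nu\ge0$, $\alpha>0$, $\gamma>0$ on a tree in which every node has exactly $N_*=2^{2\tilde\alpha}$ children, and suppose $\tilde\alpha<\alpha$. Then there exists a unique positive $l^2$ solution $X$ which is stationary. Moreover: (i) if $\nu=0$, then $X_j(t)=f\cdot 2^{-\frac{|j|+1}{3}(2\tilde\alpha+\alpha)}$ for all $j\in J$; (ii) if $\nu>0$ and $0<\alpha-\tilde\alpha\le\frac32\gamma$, the stationary solution is conservative and regular, in the sense that for every real $s$, $\sum_{j\in J}[2^{s|j|}X_j(t)]^2<\infty$; (iii) if $\nu>0$ and $\alpha-\tilde\alpha>\frac32\gamma$, there exists $C>0$ such that for all $f>C$ the stationary solution is not regular and exhibits anomalous dissipation.
   Context: $J$ is the set of nodes of an infinite rooted tree with root $0$. Each $j\in J$ has a generation $|j|\in\mathbb{N}$ with $|0|=0$, a set of children $\mathcal{O}_j\subset J$ with $|k|=|j|+1$ for $k\in\mathcal{O}_j$, and each $j\neq 0$ has a unique parent $\bar\jmath$ (so $j\in\mathcal{O}_{\bar\jmath}$). Every node has the same number $N_*\ge 1$ of children, and $\tilde\alpha:=\frac12\log_2 N_*$. The tree dyadic system is $$X_{\bar0}(t)\equiv f,\qquad \frac{d}{dt}X_j=-\nu d_jX_j+c_jX_{\bar\jmath}^2-\sum_{k\in\mathcal{O}_j}c_kX_jX_k,\quad j\in J,$$ with $c_j=2^{\alpha|j|}$, $d_j=2^{\gamma|j|}$; here $\bar 0$ is a symbol for a fictitious parent of the root, not an element of $J$,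 and $X_{\bar 0}$ is an alias for the constant forcing term. A componentwise solution is a family $X=(X_j)_{j\in J}$ of continuously differentiable functions $X_j:[0,\infty)\to\mathbb{R}$ satisfying all the equations. It is an $l^2$ solution if $X(t)\in l^2(J;\mathbb{R})$ for all $t\ge0$, positive if $X_j(t)\ge0$ for all $j\in J$, $t\ge0$, and stationary if it is constant in time. Let $\mathcal{E}(t)=\sum_{j\in J}X_j^2(t)$. A positive $l^2$ solution is conservative in $[s,t]$, $0\le s<t$, if $$\mathcal{E}(t)=\mathcal{E}(s)+2f^2\int_s^tX_0(u)\,du-2\nu\sum_{j\in J}d_j\int_s^tX_j^2(u)\,du$$ (equivalently $\lim_{n\to\infty}\int_s^t\sum_{|k|=n}c_kX_{\bar k}^2(u)X_k(u)\,du=0$); otherwise it has anomalous dissipation in $[s,t]$. For a stationary solution these notions do not depend on the interval $[s,t]$, so the interval is omitted. In (iii), $C$ may depend on $\nu,\alpha,\tilde\alpha,\gamma$ but not on $f$. *)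

(* Defs.v *)
From HB Require Import structures.
From mathcomp Require Import all_boot all_order all_algebra.
From mathcomp Require Import finmap.
From mathcomp Require Import all_classical all_reals all_analysis.

Set Implicit Arguments.
Unset Strict Implicit.
Unset Printing Implicit Defensive.

Import Order.TTheory GRing.Theory Num.Theory.
Import numFieldNormedType.Exports.

Local Open Scope classical_set_scope.
Local Open Scope ring_scope.

(* [parent j = None] means that the parent of [j] is the fictitious one, which
   is the case of the root only. *)
Record regular_tree (J : choiceType) (N : nat) := RegularTree {
  root : J;
  generation : J -> nat;
  children : J -> {fset J};
  parent : J -> option J;
  generation_root : generation root = 0%N;
  generation_children : forall j k,
    k \in children j -> generation k = (generation j).+1;
  parent_root : forall j, parent j = None <-> j = root;
  parent_children : forall j k, parent k = Some j <-> k \in children j;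
  card_children : forall j, #|` children j| = N }.

Definition alpha_tilde (R : realType) (N : nat) : R := (ln N%:R / ln 2) / 2.

Definition coef_c (R : realType) (J : choiceType) (N : nat)
    (T : regular_tree J N) (alpha : R) (j : J) : R :=
  2 `^ (alpha * (generation T j)%:R).

Definition coef_d (R : realType) (J : choiceType) (N : nat)
    (T : regular_tree J N) (gamma : R) (j : J) : R :=
  2 `^ (gamma * (generation T j)%:R).

(* Only the values of [g] at nonnegative times matter; at [t = 0] this is the
   right derivative. *)
Definition has_derivative (R : realType) (g : R -> R) (t l : R) : Prop :=
  (g u - g t) / (u - t) @[u --> within `[0, +oo[ t^'] --> l.

Definition continuously_differentiable (R : realType) (g : R -> R) : Prop :=
  exists g' : R -> R, {within `[0, +oo[, continuous g'} /\
    forall t, 0 <= t -> has_derivative g t (g' t).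

Definition parent_component (R : realType) (J : choiceType) (N : nat)
    (T : regular_tree J N) (f : R) (X : J -> R -> R) (j : J) (t : R) : R :=
  if parent T j is Some i then X i t else f.

Definition componentwise_solution (R : realType) (J : choiceType) (N : nat)
    (T : regular_tree J N) (f nu alpha gamma : R) (X : J -> R -> R) : Prop :=
  (forall j, continuously_differentiable (X j)) /\
  forall j t, 0 <= t ->
    has_derivative (X j) t
      (- nu * coef_d T gamma j * X j t
       + coef_c T alpha j * parent_component T f X j t ^+ 2
       - \sum_(k <- children T j) coef_c T alpha k * X j t * X k t).

Definition energy (R : realType) (J : choiceType) (X : J -> R -> R) (t : R)
    : \bar R :=
  (\esum_(j in [set: J]) ((X j t) ^+ 2)%:E)%E.

Definition square_summable (R : realType) (J : choiceType) (X : J -> R -> R)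
    : Prop :=
  forall t, 0 <= t -> (energy X t < +oo)%E.

Definition positive (R : realType) (J : choiceType) (X : J -> R -> R) : Prop :=
  forall j t, 0 <= t -> 0 <= X j t.

Definition stationary (R : realType) (J : choiceType) (X : J -> R -> R)
    : Prop :=
  forall j s t, 0 <= s -> 0 <= t -> X j s = X j t.

Definition stationary_solution (R : realType) (J : choiceType) (N : nat)
    (T : regular_tree J N) (f nu alpha gamma : R) (X : J -> R -> R) : Prop :=
  [/\ componentwise_solution T f nu alpha gamma X,
      square_summable X,
      positive X &
      stationary X].

(* The balance is stated in the extended reals, where [0 * +oo = 0]: the viscous
   term vanishes when [nu = 0], whether or not the series converges. *)
Definition conservative_in (R : realType) (J : choiceType) (N : nat)
    (T : regular_tree J N) (f nu gamma : R) (X : J -> R -> R) (s t : R)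
    : Prop :=
  (energy X t =
     energy X s
     + (2 * f ^+ 2)%:E *
         \int[lebesgue_measure]_(u in `[s, t]) (X (root T) u)%:E
     - (2 * nu)%:E *
         \esum_(j in [set: J])
           ((coef_d T gamma j)%:E *
              \int[lebesgue_measure]_(u in `[s, t]) ((X j u) ^+ 2)%:E))%E.

(* The two notions below are meant for stationary solutions, for which they do
   not depend on the interval. *)
Definition conservative (R : realType) (J : choiceType) (N : nat)
    (T : regular_tree J N) (f nu gamma : R) (X : J -> R -> R) : Prop :=
  forall s t, 0 <= s -> s < t -> conservative_in T f nu gamma X s t.

Definition anomalous_dissipation (R : realType) (J : choiceType) (N : nat)
    (T : regular_tree J N) (f nu gamma : R) (X : J -> R -> R) : Prop :=
  forall s t, 0 <= s -> s < t -> ~ conservative_in T f nu gamma X s t.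

Definition regular (R : realType) (J : choiceType) (N : nat)
    (T : regular_tree J N) (X : J -> R -> R) : Prop :=
  forall s t, 0 <= t ->
    (\esum_(j in [set: J])
       ((2 `^ (s * (generation T j)%:R) * X j t) ^+ 2)%:E < +oo)%E.

(* Main.v *)
Require Import Defs.
From HB Require Import structures.
From mathcomp Require Import all_boot all_order all_algebra.
From mathcomp Require Import finmap.
From mathcomp Require Import all_classical all_reals all_analysis.
From mathcomp Require Import ring lra.

Import Order.TTheory GRing.Theory Num.Theory.
Import numFieldNormedType.Exports.

Local Open Scope classical_set_scope.
Local Open Scope ring_scope.

(* For a stationary solution [x] the equations read
   [x_j (nu d_j + sum_k c_k x_k) = c_j x_p^2], with [p] the parent of [j] and
   the sum over its children.

   Uniqueness. If two positive solutions [x] and [y] agree at the parent of a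
   node but not at the node, there is a path of descendants along which
   [ln x - ln y] changes sign at every step, with a gap which doubles at every
   generation. On the other hand, a bounded solution satisfies
   [ln x_k >= 2 ln x_j - O(|k|)] for a child [k] of [j], so a suitably shifted
   [ln x / 2^n] is nondecreasing along the path and bounded above. The same
   holds for [y], and the alternating gap forces the sum of the two quantities to
   grow by a fixed amount at each step, a contradiction.

   Existence. With [theta^3 = N 2^alpha] and [x_j = f theta^-(n+1) w_(n+1)] for
   [n = |j|], the system becomes [w_0 = 1] and
   [w_(n+1) (w_(n+2) + eps q^n) = w_n^2] with [eps = nu / (f theta)]; moreover
   [q >= 1] exactly when [alpha - alpha_tilde <= 3/2 gamma]. Truncated systems
   are solved by the intermediate value theorem, and Tychonoff's theorem provides
   a limit. For [q < 1] and [eps <= 1 - q], the supersolution [1/2 + q^n/2] allows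
   truncated solutions with last value at least [1/2].

   Energy balance. The flux [w_n^2 w_(n+1)] decreases by [eps q^n w_(n+1)^2] at
   each step. For [q >= 1] this makes [w] tend to [0], then superexponentially
   fast since [w_(n+1) <= w_n^2 / eps]. For [q < 1] and [w >= 1/2] the flux does
   not tend to [0]. *)

(** * The scalar recurrence *)

Section Recurrence.
Context {R : realType}.
Variable e : nat -> R.
Hypothesis e_ge0 : forall n, 0 <= e n.

Definition recurrence (w : nat -> R) :=
  forall n, w n.+1 * (w n.+2 + e n) = w n ^+ 2.

(* The value at [n] of the solution truncated [k] indices later, where it takes
   the value [s] twice; the recurrence is solved downwards, which is stable. *)
Fixpoint backward (k n : nat) (s : R) : R :=
  if k is k'.+1 then
    if k' is k''.+1 then
      Num.sqrt (backward k' n.+1 s * (backward k'' n.+2 s + e n))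
    else s
  else s.

Lemma backwardSS k n s : backward k.+2 n s =
  Num.sqrt (backward k.+1 n.+1 s * (backward k n.+2 s + e n)).
Proof. by []. Qed.

Lemma nat_ind2 (P : nat -> Prop) : P 0%N -> P 1%N ->
  (forall k, P k -> P k.+1 -> P k.+2) -> forall k, P k.
Proof.
move=> P0 P1 PS k; suff [] : P k /\ P k.+1 by [].
by elim: k => [|k [Pk PSk]]; split => //; apply: PS.
Qed.

Lemma backward_continuous k n : continuous (backward k n).
Proof.
elim/nat_ind2: k n => [|| k IHk IHSk] n s; do ?exact: cvg_id.
apply: (@continuous_comp _ _ _
  (fun s => backward k.+1 n.+1 s * (backward k n.+2 s + e n)) Num.sqrt).
  by apply: cvgM; [exact: IHSk|apply: cvgD; [exact: IHk|exact: cvg_cst]].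
exact: sqrt_continuous.
Qed.

(** A nonnegative constant is a subsolution, [s * s <= s * (s + e n)], and the downward step is
    monotone in the two later values. *)
Lemma le_backward k n s : 0 <= s -> s <= backward k n s.
Proof.
move=> s0; elim/nat_ind2: k n => [|| k IHk IHSk] n //.
have sE : s <= backward k n.+2 s + e n by rewrite (le_trans (IHk n.+2)) ?lerDl.
rewrite backwardSS -[leLHS]ger0_norm// -sqrtr_sqr ler_sqrt ?sqr_ge0 //.
  by rewrite expr2 ler_pM.
by rewrite mulr_ge0 // (le_trans s0).
Qed.

(** Comparison principle: a supersolution above the terminal value stays above through every
    downward step. *)
Lemma backward_le (u : nat -> R) k n s : 0 <= s ->
    (forall n, s <= u n) ->
    (forall n, u n.+1 * (u n.+2 + e n) <= u n ^+ 2) ->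
  backward k n s <= u n.
Proof.
move=> s0 su usup; elim/nat_ind2: k n => [|| k IHk IHSk] n //.
have u0 m : 0 <= u m by rewrite (le_trans s0) ?su.
have b0 i m : 0 <= backward i m s by rewrite (le_trans s0) ?le_backward.
rewrite backwardSS -[leRHS]ger0_norm// -sqrtr_sqr ler_sqrt ?sqr_ge0 //.
apply: le_trans (usup n).
apply: ler_pM; rewrite ?addr_ge0 ?lerD2r //; exact: b0.
Qed.

Lemma backward_eq k n s : 0 <= s ->
  backward k.+1 n.+1 s * (backward k n.+2 s + e n) = backward k.+2 n s ^+ 2.
Proof.
move=> s0; rewrite backwardSS sqr_sqrtr // mulr_ge0 ?addr_ge0 //;
    by rewrite (le_trans s0) ?le_backward.
Qed.

Lemma truncated_solution (a : R) m : 0 <= a <= 1 -> backward m 0 a <= 1 ->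
  exists2 s, a <= s <= 1 & backward m 0 s = 1.
Proof.
move=> /andP[a0 a1] ba.
have b1 : 1 <= backward m 0 1 by apply: le_backward.
have [||s sI sE] := @IVT R (backward m 0) a 1 1 a1.
- exact/continuous_subspaceT/backward_continuous.
- by rewrite ge_min ba le_max b1 orbT.
- by exists s => //; move: sI; rewrite in_itv.
Qed.

(** Stated for an arbitrary filter so that it applies to coordinate projections of the product
    topology. *)
Lemma cvg_residual (T : Type) (F : set_system T) (FF : Filter F)
    (x y z : T -> R) (k lx ly lz : R) :
    x @ F --> lx -> y @ F --> ly -> z @ F --> lz ->
  (y t * (z t + k) - x t * x t) @[t --> F] --> ly * (lz + k) - lx * lx.
Proof.
move=> xl yl zl; apply: cvgB; last exact: cvgM.
by apply: cvgM => //; apply: cvgD => //; exact: cvg_cst.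
Qed.

(** Truncated solutions equal to 1 at index 0 lie in a product of segments independent of [m]; each
    required condition is closed and passes to a cluster point. *)
Lemma recurrence_exists (a : R) : (forall n, 0 < e n) -> 0 <= a <= 1 ->
    (forall m, backward m 0 a <= 1) ->
  exists w, [/\ w 0%N = 1, recurrence w & forall n, a <= w n].
Proof.
move=> e_gt0 a01 ba; have /andP[a0 a1] := a01.
have /choice[s Hs] m : exists s, a <= s <= 1 /\ backward m 0 s = 1.
  by have [s] := truncated_solution a m a01 (ba m); exists s.
have s_ge0 m : 0 <= s m.
  by have [/andP[sa _] _] := Hs m; apply: le_trans sa.
(* The recurrence gives [w n.+1 * e n <= w n ^+ 2]; the maximum with 1 covers indices past the
   truncation, where the value is [s m <= 1]. *)
pose b := fix b n := if n is n'.+1 then Num.max 1 (b n' ^+ 2 / e n') else 1.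
pose X m : nat -> R := fun n => backward (m - n) n (s m).
have X_ge m n : a <= X m n.
  by have [/andP[sa _] _] := Hs m; rewrite (le_trans sa) ?le_backward.
have X_eq m n : (n.+2 <= m)%N -> X m n.+1 * (X m n.+2 + e n) = X m n ^+ 2.
  move=> nm; rewrite /X.
  have -> : (m - n = (m - n.+2).+2)%N by rewrite -subnSK 1?ltnW// -subnSK.
  have -> : (m - n.+1 = (m - n.+2).+1)%N by rewrite -subnSK.
  by rewrite backward_eq.
have X_le m n : X m n <= b n.
  elim: n => [|n IHn]; first by rewrite /X subn0; have [_ ->] := Hs m.
  rewrite /= le_max; have [nm|mn] := leqP n.+2 m.
    apply/orP; right; rewrite ler_pdivlMr //.
    apply: (@le_trans _ _ (X m n ^+ 2)); last first.
      by rewrite ler_sqr ?nnegrE ?(le_trans a0) // (le_trans (X_ge m n)).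
    rewrite -X_eq // ler_wpM2l ?lerDr ?(le_trans a0) //.
  rewrite /X; have /eqP -> : (m - n.+1 == 0)%N by rewrite subn_eq0.
  by have [/andP[_ ->] _] := Hs m.
pose A := [set f : forall n : nat, R | forall n, `[0, b n]%classic (f n)].
have cA : compact (A : set (prod_topology (fun _ : nat => R))).
  apply: (@tychonoff _ (fun=> R) (fun n => `[0, b n]%classic)) => n.
  exact: segment_compact.
have [|w [Aw clw]] := cA ((X : nat -> prod_topology (fun _ : nat => R)) @ \oo).
  exists 0%N => // m _ n; rewrite /= in_itv.
  apply/andP; split; last exact: X_le.
  exact: le_trans (X_ge m n).
(* A closed condition on a continuous function of the sequence, if it holds eventually in [m], holds
   at the cluster point. *)
have cl_limit (g : prod_topology (fun _ : nat => R) -> R) (B : set R) :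
    continuous g -> closed B -> (\forall m \near \oo, B (g (X m))) -> B (g w).
  move=> gc Bc gB.
  have : closed (g @^-1` B) by apply: preimage_closed => // ? _; exact: gc.
  rewrite -[B (g w)]/((g @^-1` B) w) => /closure_id ->.
  by move: clw; rewrite clusterE; apply.
have pr n (f : prod_topology (fun _ : nat => R)) :
    (fun h : prod_topology (fun _ : nat => R) => (h n : R)) @ f --> (f n : R).
  exact: (@proj_continuous _ (fun _ => R) n f).
exists w; split.
- apply: (cl_limit (fun f => f 0%N) [set 1]) => //; first exact: pr.
  by exists 0%N => // m _; rewrite /= /X subn0; have [_ ->] := Hs m.
- move=> n; apply/eqP; rewrite -subr_eq0; apply/eqP.
  apply: (cl_limit (fun f => f n.+1 * (f n.+2 + e n) - f n * f n) [set 0]) =>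
    //.
    move=> f; have p0 := pr n f; have p1 := pr n.+1 f; have p2 := pr n.+2 f.
    have := cvg_residual _ _ _ _ _ _ (e n) _ _ _ p0 p1 p2.
    exact.
  by exists n.+2 => // m /= nm; rewrite X_eq // -expr2 subrr.
- move=> n; apply: (cl_limit (fun f => f n) [set x | a <= x]) => [||].
  - exact: pr.
  - exact: closed_ge.
  - by exists 0%N => // m _; exact: X_ge.
Qed.

(** Multiplying the recurrence by [w n.+1] writes each summand as a difference of consecutive
    fluxes, so the sum telescopes. *)
Lemma recurrence_flux w n : w 0%N = 1 -> recurrence w ->
  \sum_(0 <= i < n) e i * w i.+1 ^+ 2 = w 1%N - w n ^+ 2 * w n.+1.
Proof.
move=> w0 w_eq; elim: n => [|n IHn].
  by rewrite big_geq // w0 expr1n mul1r subrr.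
by rewrite big_nat_recr //= IHn -w_eq; ring.
Qed.

End Recurrence.

(** * Series with nonnegative terms *)

Lemma nneseries_le_bound {R : realType} (a : nat -> R) (C : R) :
    (forall n, 0 <= a n) -> (forall n, \sum_(0 <= i < n) a i <= C) ->
  (\sum_(i <oo) (a i)%:E <= C%:E)%E.
Proof.
move=> a0 aC; apply: lime_le.
  by apply: is_cvg_nneseries => n _ _; rewrite lee_fin.
by apply: nearW => n; rewrite sumEFin lee_fin.
Qed.

Lemma nneseries_cvg {R : realType} (a : nat -> R) (l : R) :
    (\sum_(0 <= i < n) a i) @[n --> \oo] --> l ->
  (\sum_(i <oo) (a i)%:E = l%:E)%E.
Proof.
move=> al; apply/cvg_lim => //.
under eq_fun do rewrite sumEFin.
by apply: cvg_EFin => //; exact: nearW.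
Qed.

(** From [n0] on, the partial sum up to [n] plus [2 * a n] is nonincreasing. *)
Lemma ratio_test_bound {R : realType} (a : nat -> R) :
    (forall n, 0 <= a n) -> (\forall n \near \oo, 2 * a n.+1 <= a n) ->
  exists C, forall n, \sum_(0 <= i < n) a i <= C.
Proof.
move=> a0 [n0 _ an0]; exists (\sum_(0 <= i < n0) a i + 2 * a n0) => n.
have S_mono m k : \sum_(0 <= i < m) a i <= \sum_(0 <= i < m + k) a i.
  by rewrite (big_cat_nat _ (leq_addr k m)) //= lerDl sumr_ge0.
have S_le k : \sum_(0 <= i < n0 + k) a i + 2 * a (n0 + k)%N <=
    \sum_(0 <= i < n0) a i + 2 * a n0.
  elim: k => [|k IHk]; first by rewrite addn0.
  apply: le_trans IHk; rewrite addnS big_nat_recr //= -addrA lerD2l.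
  have := an0 (n0 + k)%N (leq_addr _ _); lra.
apply: le_trans (S_le n); apply: le_trans (S_mono n n0) _.
by rewrite addnC lerDl mulr_ge0.
Qed.

(** * Geometric viscosities *)

Section Geometric.
Context {R : realType}.
Variables (eps q : R).
Hypotheses (eps_gt0 : 0 < eps) (q_gt0 : 0 < q).
Let e n := eps * q ^+ n.

Let e_gt0 n : 0 < e n. Proof. by rewrite mulr_gt0 ?exprn_gt0. Qed.
Let e_ge0 n : 0 <= e n. Proof. exact: ltW. Qed.

Lemma geometric_solution_exists :
  exists w, [/\ w 0%N = 1, recurrence e w & forall n, 0 <= w n].
Proof.
apply: recurrence_exists => //; first by rewrite lexx ler01.
move=> m; apply: le_trans ler01.
pose u (n : nat) : R := 0.
by apply: (@backward_le _ e _ u) => // n; rewrite mul0r expr0n.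
Qed.

Lemma geometric_solution_ge_half : q < 1 -> eps <= 1 - q ->
  exists w, [/\ w 0%N = 1, recurrence e w & forall n, 1 / 2 <= w n].
Proof.
move=> q1 epsq; apply: recurrence_exists => //; first lra.
move=> m; pose u (n : nat) : R := 1 / 2 + q ^+ n / 2.
rewrite [leRHS](_ : 1 = u 0%N); last by rewrite /u expr0; lra.
have qn n : 0 < q ^+ n by rewrite exprn_gt0.
apply: backward_le => // n; first by have := qn n; rewrite /u; lra.
rewrite expr2 /u /e !exprS; have := qn n; set t := q ^+ n => t0.
have tq1 : q * t <= t by rewrite ger_pMl // ltW.
have qt0 : 0 <= 1 + q * t by rewrite addr_ge0 // mulr_ge0 // ltW.
(* Four times the gap in the supersolution inequality equals twice this product plus the next
   two. *)
have : 0 <= (1 + q * t) * (t * (1 - q - eps)).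
  by rewrite mulr_ge0 // mulr_ge0 ?subr_ge0 // ltW.
have : 0 <= (1 + q * t) * (q * (t - q * t)).
  by rewrite mulr_ge0 // mulr_ge0 ?subr_ge0 // ltW.
have : 0 <= (1 - q) * (t * (t - q * t)).
  by rewrite mulr_ge0 ?subr_ge0 ?(ltW q1) // mulr_ge0 ?subr_ge0 // ltW.
nra.
Qed.

(** * Nondecreasing viscosities: decay of the solution *)

Section Supercritical.
Hypothesis q_ge1 : 1 <= q.
Variable w : nat -> R.
Hypotheses (w0 : w 0%N = 1) (w_ge0 : forall n, 0 <= w n)
  (w_eq : recurrence e w).

Let eps_le n : eps <= e n.
Proof. by rewrite ler_peMr ?exprn_ege1 // ltW. Qed.

(** Every [e n] is at least [eps], so the flux identity bounds the sum of the squares by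
    [w 1 / eps]. *)
Lemma supercritical_sqr_cvg0 : w n.+1 ^+ 2 @[n --> \oo] --> 0.
Proof.
apply: (@cvg_series_cvg_0 _ _ (fun n => w n.+1 ^+ 2)).
apply: nondecreasing_is_cvgn.
  by apply: nondecreasing_series => n _ _; rewrite sqr_ge0.
exists (w 1%N / eps) => _ [n _ <-] /=.
rewrite ler_pdivlMr // seriesEnat /= mulr_suml.
apply: (@le_trans _ _ (\sum_(0 <= i < n) e i * w i.+1 ^+ 2)).
  by apply: ler_sum => i _; rewrite mulrC ler_wpM2r ?sqr_ge0.
by rewrite (recurrence_flux _ _ _ w0 w_eq) gerBl mulr_ge0 ?sqr_ge0.
Qed.

Lemma supercritical_le n : w n.+1 <= w n ^+ 2 / eps.
Proof.
rewrite ler_pdivlMr // -w_eq ler_wpM2l // (le_trans (eps_le n)) //.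
by rewrite lerDr.
Qed.

(** The remaining flux [w n ^+ 2 * w n.+1] is at most [w n ^+ 4 / eps] and vanishes in the limit:
    viscosity consumes the whole input. *)
Lemma supercritical_flux_cvg0 :
  \sum_(0 <= i < n) e i * w i.+1 ^+ 2 @[n --> \oo] --> w 1%N.
Proof.
rewrite -[w 1%N]subr0.
under eq_fun do rewrite (recurrence_flux _ _ _ w0 w_eq).
apply: cvgB; first exact: cvg_cst.
rewrite -(cvg_shiftS (fun n => w n ^+ 2 * w n.+1)) /=.
have h := supercritical_sqr_cvg0.
have up : w n.+1 ^+ 2 * (w n.+1 ^+ 2 / eps) @[n --> \oo] --> 0.
  rewrite -(mul0r (0 / eps)).
  by apply: cvgM => //; apply: cvgM => //; exact: cvg_cst.
apply: squeeze_cvgr (cvg_cst 0) up; apply: nearW => n.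
by rewrite mulr_ge0 ?sqr_ge0 // ler_wpM2l ?sqr_ge0 ?supercritical_le.
Qed.

Lemma supercritical_bound rho : 0 <= rho ->
  exists C, forall n, \sum_(0 <= i < n) rho ^+ i * w i.+1 ^+ 2 <= C.
Proof.
move=> rho0; apply: ratio_test_bound => [n|].
  by rewrite mulr_ge0 ?exprn_ge0 ?sqr_ge0.
(* Consecutive terms have ratio at most [rho * w n.+1 ^+ 2 / eps ^+ 2], hence at most 1/2 once
   [w n.+1 ^+ 2 <= d]; the [+ 1] covers [rho = 0]. *)
pose d := eps ^+ 2 / (2 * (rho + 1)).
have rho1 : 0 < 2 * (rho + 1) by lra.
have d0 : 0 < d by rewrite divr_gt0 ?exprn_gt0.
have := supercritical_sqr_cvg0 => /cvgrPdist_le /(_ _ d0).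
apply: filterS => n; rewrite sub0r normrN ger0_norm ?sqr_ge0 // => wd.
rewrite exprS mulrCA -mulrA mulrCA ler_wpM2l ?exprn_ge0 //.
have := supercritical_le n.+1; move: wd; rewrite /d ler_pdivlMr //.
set x := w n.+1; set y := w n.+2 => xd yx.
have y2 : y ^+ 2 <= (x ^+ 2 / eps) ^+ 2.
  by rewrite ler_sqr ?nnegrE ?w_ge0 ?divr_ge0 ?sqr_ge0 // ltW.
rewrite expr_div_n ler_pdivlMr ?exprn_gt0 // in y2.
have x0 : 0 <= x ^+ 2 by rewrite sqr_ge0.
have y0 : 0 <= y ^+ 2 by rewrite sqr_ge0.
have e20 : 0 < eps ^+ 2 by rewrite exprn_gt0.
rewrite -(ler_pM2r e20).
have h1 := ler_wpM2l rho0 y2.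
have h2 := ler_wpM2l x0 xd.
have h3 : 0 <= (x ^+ 2) ^+ 2 by rewrite sqr_ge0.
move: h1 h2 h3; rewrite !expr2.
nra.
Qed.

End Supercritical.
End Geometric.

(** * Uniqueness *)

Lemma regular_tree_ind (J : choiceType) (N : nat) (T : regular_tree J N)
    (P : J -> Prop) :
    P (Defs.root T) -> (forall j k, k \in children T j -> P j -> P k) ->
  forall j, P j.
Proof.
move=> P0 PS j; have [n] := ubnP (generation T j); elim: n j => // n IHn j jn.
case pj: (parent T j) => [i|]; last by rewrite (parent_root T j).1.
have jc : j \in children T i by apply/parent_children.
apply: (PS _ _ jc); apply: IHn.
by rewrite -ltnS -(generation_children jc).
Qed.

Lemma ln_sqr {R : realType} (x : R) : 0 < x -> ln (x ^+ 2) = 2 * ln x.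
Proof. by move=> x0; rewrite lnXn // mulr_natl. Qed.

Section Uniqueness.
Context {R : realType} {J : choiceType} {N : nat}.
Variables (T : regular_tree J N) (f nu alpha gamma : R).
Hypotheses (N_gt0 : (0 < N)%N) (f_gt0 : 0 < f) (nu_ge0 : 0 <= nu)
  (alpha_gt0 : 0 < alpha) (gamma_gt0 : 0 < gamma).

Definition parent_value (x : J -> R) (j : J) : R :=
  if parent T j is Some i then x i else f.

Definition damping (x : J -> R) (j : J) : R :=
  nu * coef_d T gamma j + \sum_(k <- children T j) coef_c T alpha k * x k.

Definition balanced (x : J -> R) : Prop :=
  forall j, x j * damping x j = coef_c T alpha j * parent_value x j ^+ 2.

Let c_gt0 j : 0 < coef_c T alpha j. Proof. exact: powR_gt0. Qed.
Let d_gt0 j : 0 < coef_d T gamma j. Proof. exact: powR_gt0. Qed.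

Let c_ge1 j : 1 <= coef_c T alpha j.
Proof. by rewrite -[leLHS](powRr0 2) ler_powR ?ler1n // mulr_ge0 // ltW. Qed.
Let d_ge1 j : 1 <= coef_d T gamma j.
Proof. by rewrite -[leLHS](powRr0 2) ler_powR ?ler1n // mulr_ge0 // ltW. Qed.

Lemma parent_value_root x : parent_value x (Defs.root T) = f.
Proof. by rewrite /parent_value (parent_root T _).2. Qed.

Lemma parent_value_child x j k : k \in children T j -> parent_value x k = x j.
Proof. by move=> /parent_children; rewrite /parent_value => ->. Qed.

(** A zero at a node would force, through its equation, a zero at its parent; positivity thus
    descends from the forcing [f]. *)
Lemma balanced_gt0 x : (forall j, 0 <= x j) -> balanced x -> forall j, 0 < x j.
Proof.
move=> x0 xb.
have step j : 0 < parent_value x j -> 0 < x j.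
  rewrite !lt_neqAle x0 !(eq_sym 0) => /andP[pj _]; rewrite andbT.
  apply: contra_neq pj => xj0; apply/eqP; rewrite -sqrf_eq0.
  have /esym/eqP := xb j.
  by rewrite xj0 mul0r mulf_eq0 gt_eqF ?c_gt0.
apply: (regular_tree_ind _ _ T).
  by apply: step; rewrite parent_value_root.
by move=> j k jk xj; apply: step; rewrite (parent_value_child x j).
Qed.

Section TwoSolutions.
Variable M : R.
Hypothesis M_ge1 : 1 <= M.

Definition bounded_solution (x : J -> R) :=
  [/\ balanced x, forall j, 0 < x j & forall j, x j <= M].

Let K := nu + N%:R * 2 `^ alpha * M.

Let M_le_K : M <= K.
Proof.
have N1 : 1 <= N%:R * 2 `^ alpha :> R.
  have a1 : 1 <= 2 `^ alpha.
    by rewrite -[leLHS](powRr0 2) ler_powR ?ler1n // ltW.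
  by rewrite -[leLHS]mulr1 ler_pM ?ler1n.
by rewrite -[M]add0r lerD // ler_peMl // (le_trans ler01).
Qed.

Let K_gt0 : 0 < K. Proof. exact: lt_le_trans ltr01 (le_trans M_ge1 M_le_K). Qed.

Lemma sum_coef_c_children j : \sum_(k <- children T j) coef_c T alpha k =
  N%:R * 2 `^ alpha * coef_c T alpha j.
Proof.
rewrite (eq_big_seq (fun=> 2 `^ alpha * coef_c T alpha j)) /=; last first.
  move=> k jk; rewrite /coef_c (generation_children jk) -powRD.
    by congr (_ `^ _); rewrite -natr1; ring.
  by rewrite pnatr_eq0 implybT.
rewrite big_const_seq count_predT.
by rewrite card_children iter_addr_0 -[_ *+ N]mulr_natl mulrA.
Qed.

(** Since both coefficients are at least 1, the sum is bounded by a product, which suits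
    logarithms. *)
Lemma damping_le x j : bounded_solution x ->
  damping x j <= K * coef_d T gamma j * coef_c T alpha j.
Proof.
move=> [_ x0 xM].
have -> : K * coef_d T gamma j * coef_c T alpha j =
    nu * coef_d T gamma j * coef_c T alpha j +
    (N%:R * 2 `^ alpha * coef_c T alpha j * M) * coef_d T gamma j.
  by rewrite /K; ring.
apply: lerD; first by rewrite ler_peMr // mulr_ge0 // ltW.
rewrite -sum_coef_c_children mulr_suml.
apply: (@le_trans _ _ (\sum_(k <- children T j) coef_c T alpha k * M)).
  by apply: ler_sum => k _; rewrite ler_wpM2l // ltW.
rewrite ler_peMr // sumr_ge0 // => k _.
by rewrite mulr_ge0 ?(le_trans ler01) // ltW.
Qed.

Lemma parent_value_gt0 x j : bounded_solution x -> 0 < parent_value x j.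
Proof. by move=> [_ x0 _]; rewrite /parent_value; case: (parent T j). Qed.

(** The coefficient [c] cancels between the balance and the damping bound, so only the growth of [d]
    costs a term linear in the generation. *)
Lemma ln_balanced_ge x j : bounded_solution x ->
  2 * ln (parent_value x j) - gamma * ln 2 * (generation T j)%:R - ln K
  <= ln (x j).
Proof.
move=> xs; have [xb x0 xM] := xs; have p0 := parent_value_gt0 x j xs.
have le1 : parent_value x j ^+ 2 <= x j * (K * coef_d T gamma j).
  rewrite -(ler_pM2l (c_gt0 j)) -xb.
  rewrite [leRHS](_ : _ = x j * (K * coef_d T gamma j * coef_c T alpha j)).
    by rewrite ler_wpM2l ?damping_le // ltW.
  by ring.
have lnd : ln (coef_d T gamma j) = gamma * ln 2 * (generation T j)%:R.
  by rewrite ln_powR; ring.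
have : ln (parent_value x j ^+ 2) <= ln (x j * (K * coef_d T gamma j)).
  by rewrite ler_ln ?posrE ?exprn_gt0 // !mulr_gt0.
rewrite (ln_sqr _ p0) !lnM ?posrE ?mulr_gt0 // lnd; lra.
Qed.

(* The shift makes [ln_balanced_ge] read [2 * z j <= z k] for the numerators at
   a node and at its child, and makes them nonpositive. *)
Definition scaled_log (x : J -> R) (j : J) : R :=
  (ln (x j) - gamma * ln 2 * (generation T j).+2%:R - ln K) /
  2 ^+ generation T j.

Let ln2_ge0 : 0 <= ln 2 :> R. Proof. by rewrite ln_ge0 // ler1n. Qed.

Lemma scaled_log_le0 x j : bounded_solution x -> scaled_log x j <= 0.
Proof.
move=> [_ x0 xM]; rewrite /scaled_log pmulr_lle0 ?invr_gt0 ?exprn_gt0 //.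
have : ln (x j) <= ln K by rewrite ler_ln ?posrE // (le_trans (xM j)).
have : 0 <= gamma * ln 2 * (generation T j).+2%:R.
  by rewrite !mulr_ge0 // ltW.
lra.
Qed.

(** With [n] the generation of [j], the shifts match because [(n + 1) + (n + 3) = 2 * (n + 2)], and
    the power of 2 absorbs the doubling. *)
Lemma scaled_log_child x j k : bounded_solution x -> k \in children T j ->
  scaled_log x j <= scaled_log x k.
Proof.
move=> xs jk; rewrite /scaled_log (generation_children jk) exprS invfM mulrA.
rewrite ler_pM2r ?invr_gt0 ?exprn_gt0 //.
have := ln_balanced_ge x k xs.
rewrite (parent_value_child x _ _ jk) (generation_children jk).
rewrite ler_pdivlMr // -!natr1; lra.
Qed.

Definition log_ratio (x y : J -> R) (j : J) : R := ln (x j) - ln (y j).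

Definition parent_log_ratio (x y : J -> R) (j : J) : R :=
  ln (parent_value x j) - ln (parent_value y j).

(* If the damping of [x] is at most [rho <= 1] times the damping of [y], it is
   so for at least one of the terms of the sums over the children. *)
Lemma child_log_ratio_le x y j : bounded_solution x -> bounded_solution y ->
    2 * parent_log_ratio x y j <= log_ratio x y j ->
  exists2 k, k \in children T j &
    log_ratio x y k <= 2 * parent_log_ratio x y j - log_ratio x y j.
Proof.
move=> xs ys uj; have [xb x0 xM] := xs; have [yb y0 yM] := ys.
have px := parent_value_gt0 x j xs; have py := parent_value_gt0 y j ys.
apply: contrapT => noch.
have {}noch k : k \in children T j ->
    2 * parent_log_ratio x y j - log_ratio x y j < log_ratio x y k.
  by move=> jk; rewrite ltNge; apply/negP => lek; apply: noch; exists k.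
(* The ratio of the two dampings as dictated by the balance equations. *)
pose rho := parent_value x j ^+ 2 * y j / (parent_value y j ^+ 2 * x j).
have rho0 : 0 < rho by rewrite divr_gt0 ?mulr_gt0 ?exprn_gt0.
have lnrho : ln rho = 2 * parent_log_ratio x y j - log_ratio x y j.
  rewrite /rho ln_div ?posrE ?mulr_gt0 ?exprn_gt0 //.
  rewrite [X in X - _ = _]lnM ?posrE ?exprn_gt0 //.
  rewrite [X in _ - X = _]lnM ?posrE ?exprn_gt0 //.
  rewrite (ln_sqr _ px) (ln_sqr _ py) /parent_log_ratio /log_ratio; ring.
have rho1 : rho <= 1.
  by rewrite -ler_ln ?posrE // ln1 lnrho subr_le0.
have rhoD : damping x j = rho * damping y j.
  have -> : damping x j = coef_c T alpha j * parent_value x j ^+ 2 / x j.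
    by rewrite -xb mulrAC divff ?mul1r // gt_eqF.
  have -> : damping y j = coef_c T alpha j * parent_value y j ^+ 2 / y j.
    by rewrite -yb mulrAC divff ?mul1r // gt_eqF.
  by rewrite /rho; field; rewrite !gt_eqF.
suff : rho * damping y j < damping x j by rewrite rhoD ltxx.
(* The viscous terms compare weakly since [rho <= 1]; the sums compare strictly because there is at
   least one child. *)
rewrite /damping mulrDr; apply: ler_ltD.
  by rewrite ler_piMl // mulr_ge0 // ltW.
rewrite mulr_sumr big_seq [ltRHS]big_seq; apply: ltr_sum.
  have : (0 < #|` children T j|)%N by rewrite card_children.
  by rewrite cardfs_gt0 => /fset0Pn[k jk]; apply/hasP; exists k.
move=> k /noch; rewrite -lnrho /log_ratio mulrCA ltr_pM2l // => lnk.
have : ln (rho * y k) < ln (x k) by rewrite lnM ?posrE //; lra.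
have ry0 : 0 < rho * y k by rewrite mulr_gt0.
by rewrite ltr_ln ?posrE.
Qed.

(* [x] and [y] are on opposite sides at a node and at its parent, with a
   logarithmic gap doubling at each generation. *)
Definition diverging (a : R) (x y : J -> R) (j : J) : Prop :=
  [/\ parent_log_ratio x y j <= 0, 0 <= log_ratio x y j &
      a * 2 ^+ generation T j <= log_ratio x y j - parent_log_ratio x y j].

Lemma diverging_child a x y j : bounded_solution x -> bounded_solution y ->
    diverging a x y j ->
  exists2 k, diverging a y x k &
    scaled_log x j + scaled_log y j + a <= scaled_log x k + scaled_log y k.
Proof.
move=> xs ys [u0 v0 uv].
have [|k jk uk] := child_log_ratio_le x y j xs ys; first lra.
have pk : parent_log_ratio y x k = - log_ratio x y j.
  by rewrite /parent_log_ratio !(parent_value_child _ _ _ jk) opprB.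
have lk : log_ratio y x k = - log_ratio x y k by rewrite /log_ratio opprB.
exists k.
  split; rewrite ?pk ?lk ?(generation_children jk) ?exprS; lra.
have xk := scaled_log_child x j k xs jk.
have yk := scaled_log_child y j k ys jk.
have two_g : 0 < 2 ^+ generation T j :> R by rewrite exprn_gt0.
(* The sum of the two scaled logarithms is twice that of [x] minus their difference; the former does
   not decrease, so a drop of the difference by [a] suffices. *)
suff : scaled_log x k - scaled_log y k <= scaled_log x j - scaled_log y j - a.
  lra.
have dj : scaled_log x j - scaled_log y j =
    log_ratio x y j / 2 ^+ generation T j.
  by rewrite /scaled_log -mulrBl; congr (_ / _); rewrite /log_ratio; ring.
have dk : scaled_log x k - scaled_log y k =
    log_ratio x y k / 2 / 2 ^+ generation T j.
  rewrite /scaled_log -mulrBl (generation_children jk) exprS invfM mulrA.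
  by congr (_ / _ / _); rewrite /log_ratio; ring.
rewrite dj dk ler_pdivrMr //.
rewrite [leRHS](_ : _ = log_ratio x y j - a * 2 ^+ generation T j); first lra.
by field; rewrite gt_eqF.
Qed.

Lemma bounded_solution_le x y j : bounded_solution x -> bounded_solution y ->
  parent_log_ratio x y j = 0 -> log_ratio x y j <= 0.
Proof.
move=> xs ys u0; rewrite leNgt; apply/negP => v0.
(* The largest gap for which [diverging] holds at [j] itself, where the parent ratio vanishes. *)
pose a := log_ratio x y j / 2 ^+ generation T j.
have a0 : 0 < a by rewrite divr_gt0 ?exprn_gt0.
pose S := scaled_log x j + scaled_log y j.
have grow n : exists2 k, diverging a x y k \/ diverging a y x k &
    S + n%:R * a <= scaled_log x k + scaled_log y k.
  elim: n => [|n [k kd kS]].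
    exists j; last by rewrite mul0r addr0.
    left; split; [by rewrite u0|exact: ltW|].
    by rewrite u0 subr0 /a divfK // gt_eqF // exprn_gt0.
  case: kd => /diverging_child -/(_ _ _)[]// k' k'd k'S; exists k'.
  - by right.
  - by rewrite -natr1; lra.
  - by left.
  - by rewrite -natr1; lra.
(* For this [n], [S + n * a] is positive, while both scaled logarithms are nonpositive. *)
have [n _ /(_ n (leqnn n))] := nbhs_infty_ger (- S / a + 1).
have [k _] := grow n.
have := scaled_log_le0 x k xs; have := scaled_log_le0 y k ys => yk xk Sk.
rewrite -lerBrDr ler_pdivrMr // mulrBl mul1r; lra.
Qed.

End TwoSolutions.

Lemma bounded_solution_unique M x y :
  bounded_solution M x -> bounded_solution M y -> x =1 y.
Proof.
wlog M1 : M / 1 <= M => [wh xs ys|].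
  have sM z : bounded_solution M z -> bounded_solution (Num.max 1 M) z.
    by move=> [? ? zM]; split => // j; rewrite le_max zM orbT.
  by apply: wh (sM _ xs) (sM _ ys); rewrite le_max lexx.
move=> xs ys.
have step j : parent_value x j = parent_value y j -> x j = y j.
  move=> pj; have [_ x0 _] := xs; have [_ y0 _] := ys.
  have uxy : parent_log_ratio x y j = 0 by rewrite /parent_log_ratio pj subrr.
  have uyx : parent_log_ratio y x j = 0 by rewrite /parent_log_ratio pj subrr.
  have := bounded_solution_le M M1 x y j xs ys uxy.
  have := bounded_solution_le M M1 y x j ys xs uyx.
  rewrite /log_ratio !subr_le0 !ler_ln ?posrE // => yx xy.
  by apply: le_anti; rewrite xy.
apply: (regular_tree_ind _ _ T).
  by apply: step; rewrite !parent_value_root.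
by move=> j k jk xyj; apply: step; rewrite !(parent_value_child _ _ _ jk).
Qed.

End Uniqueness.

(** * Radial solutions *)

Section Levels.
Context {J : choiceType} {N : nat}.
Variable T : regular_tree J N.

Fixpoint level (n : nat) : seq J :=
  if n is m.+1 then [seq k | i <- level m, k <- enum_fset (children T i)]
  else [:: Defs.root T].

Lemma mem_level n j : (j \in level n) = (generation T j == n).
Proof.
elim: n j => [|n IHn] j /=.
  rewrite inE; apply/eqP/eqP => [->|j0]; first exact: generation_root.
  case pj: (parent T j) => [i|]; last by rewrite (parent_root T j).1.
  have /(parent_children T) jc := pj.
  by move: j0; rewrite (generation_children jc).
apply/allpairsPdep/eqP => [[i [k [il kc ->]]]|jn].
  by rewrite (generation_children kc); move: il; rewrite IHn => /eqP ->.
case pj: (parent T j) => [i|].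
  have /(parent_children T) jc := pj.
  exists i, j; split=> //; rewrite IHn.
  by move: jn; rewrite (generation_children jc) => -[->].
by move: jn; rewrite (parent_root T j).1 // generation_root.
Qed.

(** Children of distinct nodes are distinct, since a node determines its parent. *)
Lemma level_uniq n : uniq (level n).
Proof.
elim: n => //= n IHn; apply: allpairs_uniq_dep => //.
move=> [i k] [i' k'] /allpairsPdep[a [b [_ ba abE]]].
move=> /allpairsPdep[a' [b' [_ ba' abE']]] /= kk'.
case: abE ba kk' => -> -> ba; case: abE' ba' => -> -> ba' bb'.
subst b'; move/(parent_children T): ba; move/(parent_children T): ba' => ->.
by case=> ->.
Qed.

Lemma size_level n : size (level n) = (N ^ n)%N.
Proof.
elim: n => //= n IHn; rewrite size_allpairs_dep.
rewrite expnS -IHn; elim: (level n) => [|i s /= ->]; first by rewrite muln0.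
by rewrite mulnS; congr addn; exact: card_children.
Qed.

Lemma esum_generation {R : realType} (g : nat -> R) : (forall n, 0 <= g n) ->
  (\esum_(j in [set: J]) (g (generation T j))%:E =
   \sum_(n <oo) (N%:R ^+ n * g n)%:E)%E.
Proof.
move=> g0; pose F n := [set j | generation T j = n].
have -> : [set: J] = \bigcup_n F n.
  by apply/seteqP; split=> // j _; exists (generation T j).
rewrite nneseries_sum_bigcup => [||j]; last by rewrite lee_fin.
  apply: eq_eseriesr => n _.
  rewrite (eq_esum (b := fun=> (g n)%:E)) => [|j -> //].
  have -> : F n = [set` level n].
    apply/seteqP; split=> j /=; first by move=> /eqP; rewrite mem_level.
    by rewrite mem_level => /eqP.
  rewrite esum_fset; [|exact: finite_seq|by move=> *; rewrite lee_fin].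
  rewrite -fsbig_seq ?level_uniq // sumEFin big_const_seq count_predT.
  by rewrite size_level iter_addr_0 -[_ *+ _]mulr_natl natrX.
by move=> m n _ _ [j [<- <-]].
Qed.

End Levels.

(** * Stationary solutions as balanced families *)

(** Only the right derivative is available at 0, so the limit is restricted to [0^'+], where limits
    are unique. *)
Lemma has_derivative_stationary {R : realType} (g : R -> R) (l : R) :
  (forall s t, 0 <= s -> 0 <= t -> g s = g t) -> has_derivative g 0 l -> l = 0.
Proof.
move=> gs gl.
have gr : (g u - g 0) / (u - 0) @[u --> 0^'+] --> l.
  move=> A /gl Al.
  apply: (@filterS _ (nbhs (0 : R)) _ _ _ _ Al) => u /= ul u0.
  apply: ul; first by rewrite gt_eqF.
  by rewrite /= in_itv /= andbT ltW.
have g0 : (g u - g 0) / (u - 0) @[u --> 0^'+] --> 0.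
  apply: cvg_near_cst; near=> u.
  by rewrite (gs u 0) // subrr mul0r.
exact: (cvg_unique _ gr g0).
Unshelve. all: by end_near. Qed.

Lemma has_derivative_cst {R : realType} (c t : R) :
  has_derivative (fun=> c) t 0.
Proof.
by apply: cvg_near_cst; apply: nearW => u; rewrite subrr mul0r.
Qed.

Lemma continuously_differentiable_cst {R : realType} (c : R) :
  continuously_differentiable (fun=> c).
Proof.
exists (fun=> 0); split; last by move=> t _; exact: has_derivative_cst.
by apply: continuous_subspaceT => t; exact: cvg_cst.
Qed.

Section StationarySolutions.
Context {R : realType} {J : choiceType} {N : nat}.
Variables (T : regular_tree J N) (f nu alpha gamma : R).

Lemma stationary_rhs (y : J -> R) j :
  - nu * coef_d T gamma j * y j + coef_c T alpha j * parent_value T f y j ^+ 2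
    - \sum_(k <- children T j) coef_c T alpha k * y j * y k =
  coef_c T alpha j * parent_value T f y j ^+ 2
    - y j * damping T nu alpha gamma y j.
Proof.
rewrite /damping mulrDr mulr_sumr.
have -> : \sum_(k <- children T j) coef_c T alpha k * y j * y k =
    \sum_(k <- children T j) y j * (coef_c T alpha k * y k).
  by apply: eq_bigr => k _; ring.
ring.
Qed.

Lemma sqr_le_energy (X : J -> R -> R) j t : ((X j t ^+ 2)%:E <= energy X t)%E.
Proof.
apply: esum_ge; exists [set j]; first by split.
by rewrite fsbig_set1.
Qed.

Lemma stationary_solution_bounded Y : 0 < f ->
    stationary_solution T f nu alpha gamma Y ->
  exists M, bounded_solution T f nu alpha gamma M (Y^~ 0).
Proof.
move=> f0 [[_ Yeq] Ysum Ypos Ystat].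
have Yb : balanced T f nu alpha gamma (Y^~ 0).
  move=> j; have := has_derivative_stationary _ _ (Ystat j) (Yeq j 0 (lexx _)).
  by rewrite (stationary_rhs (Y^~ 0)) => /eqP; rewrite subr_eq0 => /eqP.
have Y0 j : 0 <= Y j 0 by exact: Ypos.
(* Each square is at most the energy, and [x <= x ^+ 2 + 1] avoids a square root. *)
exists (fine (energy Y 0) + 1); split => //; first exact: balanced_gt0 Yb.
move=> j; have := sqr_le_energy Y j 0.
have /fineK <- : energy Y 0 \is a fin_num.
  rewrite ge0_fin_numE ?Ysum //.
  by apply: esum_ge0 => k _; rewrite lee_fin sqr_ge0.
rewrite lee_fin /=; have := Y0 j; nra.
Qed.

Lemma balanced_stationary_solution (y : J -> R) :
    balanced T f nu alpha gamma y -> (forall j, 0 <= y j) ->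
    (\esum_(j in [set: J]) (y j ^+ 2)%:E < +oo)%E ->
  stationary_solution T f nu alpha gamma (fun j _ => y j).
Proof.
move=> yb y0 ysum; split => //; split=> [j|j t t0].
  exact: continuously_differentiable_cst.
rewrite (stationary_rhs y) yb subrr.
exact: has_derivative_cst.
Qed.

End StationarySolutions.

(** * Scaling exponents *)

Section Exponents.
Context {R : realType}.
Implicit Types x y : R.

Lemma powR2D x y : 2 `^ (x + y) = 2 `^ x * 2 `^ y :> R.
Proof. by rewrite powRD // pnatr_eq0 implybT. Qed.

Lemma powR2Mn x n : 2 `^ (x * n%:R) = (2 `^ x) ^+ n :> R.
Proof. by rewrite powRrM powR_mulrn // powR_ge0. Qed.

Lemma powR2_gt1 x : 0 < x -> 1 < 2 `^ x :> R.
Proof.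
move=> x0; rewrite /powR pnatr_eq0 /= expR_gt1 mulr_gt0 // ln_gt0 //.
by rewrite ltr1n.
Qed.

Lemma powR2_ge1 x : 0 <= x -> 1 <= 2 `^ x :> R.
Proof. by move=> x0; rewrite -[leLHS](powRr0 2) ler_powR // ler1n. Qed.

End Exponents.

Section Scaling.
Context {R : realType} (N : nat) (alpha gamma : R).
Hypothesis N_gt0 : (0 < N)%N.

(* In the inviscid stationary solution each generation is [theta] times smaller
   than the previous one. *)
Definition theta : R := 2 `^ ((2 * alpha_tilde R N + alpha) / 3).

(** Growth of viscosity relative to transfer per generation: [d] gains [2 ^ gamma], while [c] times
    the inviscid profile gains [2 ^ alpha / theta]. *)
Definition viscous_ratio : R := 2 `^ gamma * (theta / 2 `^ alpha).

Definition viscosity_sequence (f nu : R) (n : nat) : R :=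
  nu / (f * theta) * viscous_ratio ^+ n.

(** Index [n.+1] stands for generation [n]; index 0 is the fictitious parent, so [w 0 = 1] encodes
    the forcing. *)
Definition radial_value (f : R) (w : nat -> R) (n : nat) : R :=
  f / theta ^+ n * w n.

Lemma theta_gt0 : 0 < theta. Proof. exact: powR_gt0. Qed.

Lemma viscous_ratio_gt0 : 0 < viscous_ratio.
Proof. by rewrite mulr_gt0 ?divr_gt0 ?theta_gt0 ?powR_gt0. Qed.

Let ln2_gt0 : 0 < ln 2 :> R. Proof. by rewrite ln_gt0 // ltr1n. Qed.

Lemma powR_alpha_tilde : 2 `^ (2 * alpha_tilde R N) = N%:R :> R.
Proof.
rewrite /alpha_tilde mulrCA divff ?pnatr_eq0 // mulr1.
rewrite /powR pnatr_eq0 /= divfK ?gt_eqF //.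
by rewrite lnK // posrE ltr0n.
Qed.

Lemma alpha_tilde_ge0 : 0 <= alpha_tilde R N.
Proof. by rewrite !divr_ge0 ?(ltW ln2_gt0) ?ln_ge0 ?ler1n. Qed.

Lemma theta_cube : theta ^+ 3 = N%:R * 2 `^ alpha.
Proof.
by rewrite -powR_alpha_tilde -powR2D /theta -powR2Mn divfK // pnatr_eq0.
Qed.

Lemma theta_ratioE :
  theta / 2 `^ alpha = 2 `^ (- (2 / 3 * (alpha - alpha_tilde R N))).
Proof. by rewrite /theta -powRN -powR2D; congr (_ `^ _); field. Qed.

Lemma viscous_ratioE :
  viscous_ratio = 2 `^ (gamma - 2 / 3 * (alpha - alpha_tilde R N)).
Proof. by rewrite /viscous_ratio theta_ratioE -powR2D. Qed.

Lemma theta_ratio_lt1 : alpha_tilde R N < alpha -> theta / 2 `^ alpha < 1.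
Proof.
move=> lta; rewrite theta_ratioE powRN invf_lt1 ?powR_gt0 //.
by apply: powR2_gt1; lra.
Qed.

Lemma viscous_ratio_ge1 : alpha - alpha_tilde R N <= 3 / 2 * gamma ->
  1 <= viscous_ratio.
Proof. by move=> le_ag; rewrite viscous_ratioE; apply: powR2_ge1; lra. Qed.

Lemma viscous_ratio_lt1 : 3 / 2 * gamma < alpha - alpha_tilde R N ->
  viscous_ratio < 1.
Proof.
move=> lt_ga; rewrite viscous_ratioE -[X in 2 `^ X]opprK powRN.
by rewrite invf_lt1 ?powR_gt0 //; apply: powR2_gt1; lra.
Qed.

Lemma theta_ge1 : 0 < alpha -> 1 <= theta.
Proof.
move=> a0; apply: powR2_ge1; have := alpha_tilde_ge0 => at0.
by rewrite divr_ge0 // addr_ge0 ?(ltW a0) // mulr_ge0.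
Qed.

End Scaling.

(** * Reduction of the tree system to the recurrence *)

Section Radial.
Context {R : realType} {J : choiceType} {N : nat}.
Variables (T : regular_tree J N) (f nu alpha gamma : R).
Hypotheses (N_gt0 : (0 < N)%N) (f_gt0 : 0 < f).

Let th := theta N alpha.
Let lam : R := 2 `^ alpha.
Let dl : R := 2 `^ gamma.
Let th_gt0 : 0 < th. Proof. exact: theta_gt0. Qed.
Let lam_gt0 : 0 < lam. Proof. exact: powR_gt0. Qed.
Let dl_gt0 : 0 < dl. Proof. exact: powR_gt0. Qed.
Let N_th : N%:R = th ^+ 3 / lam.
Proof. by rewrite (theta_cube _ _ N_gt0) mulfK // gt_eqF. Qed.

Definition radial (w : nat -> R) (j : J) : R :=
  radial_value N alpha f w (generation T j).+1.

Lemma coef_cE j : coef_c T alpha j = lam ^+ generation T j.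
Proof. exact: powR2Mn. Qed.

Lemma coef_dE j : coef_d T gamma j = dl ^+ generation T j.
Proof. exact: powR2Mn. Qed.

Lemma damping_radial w j : damping T nu alpha gamma (radial w) j =
  nu * dl ^+ generation T j +
  N%:R * lam ^+ (generation T j).+1 *
    radial_value N alpha f w (generation T j).+2.
Proof.
rewrite /damping coef_dE; congr (_ + _).
have -> : N%:R * lam ^+ (generation T j).+1 =
    \sum_(k <- children T j) coef_c T alpha k.
  by rewrite sum_coef_c_children coef_cE exprS mulrA.
rewrite mulr_suml; apply: eq_big_seq => k jk.
by rewrite /radial (generation_children jk).
Qed.

Lemma parent_value_radial w j : w 0%N = 1 ->
  parent_value T f (radial w) j = radial_value N alpha f w (generation T j).
Proof.
move=> w0; rewrite /parent_value; case pj: (parent T j) => [i|].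
  have /(parent_children T) jc := pj.
  by rewrite /radial (generation_children jc).
rewrite (parent_root T j).1 // generation_root /radial_value w0.
by rewrite expr0 divr1 mulr1.
Qed.

Lemma radial_balanced w : w 0%N = 1 ->
    recurrence (viscosity_sequence N alpha gamma f nu) w ->
  balanced T f nu alpha gamma (radial w).
Proof.
move=> w0 w_eq j; rewrite damping_radial (parent_value_radial _ _ w0) coef_cE.
rewrite /radial /radial_value N_th -/th; move: (generation T j) => n.
rewrite [(_ * w n) ^+ 2]exprMn -w_eq /viscosity_sequence /viscous_ratio.
rewrite -/th -/lam -/dl !exprMn !exprVn !exprS.
have : th ^+ n != 0 by rewrite expf_neq0 // gt_eqF.
have : lam ^+ n != 0 by rewrite expf_neq0 // gt_eqF.
move: (th ^+ n) (lam ^+ n) (dl ^+ n) => a b c b0 a0.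
by field; rewrite a0 b0 !gt_eqF.
Qed.

(** Because [N / th ^+ 2 = th / lam], counting the nodes of a generation leaves one geometric
    weight. *)
Lemma level_weight w b n :
  N%:R ^+ n * (b ^+ n * radial_value N alpha f w n.+1 ^+ 2) =
  (f / th) ^+ 2 * ((b * (th / lam)) ^+ n * w n.+1 ^+ 2).
Proof.
rewrite /radial_value N_th -/th !exprMn !exprVn.
rewrite [th ^+ n.+1]exprS.
have : th ^+ n != 0 by rewrite expf_neq0 // gt_eqF.
have : lam ^+ n != 0 by rewrite expf_neq0 // gt_eqF.
move: (th ^+ n) (lam ^+ n) (b ^+ n) => a c d c0 a0.
by field; rewrite a0 c0 !gt_eqF.
Qed.

Lemma radial_weight_lty w b : 0 <= b ->
    (exists C, forall n,
       \sum_(0 <= i < n) (b * (th / lam)) ^+ i * w i.+1 ^+ 2 <= C) ->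
  (\esum_(j in [set: J])
     (b ^+ generation T j * radial w j ^+ 2)%:E < +oo)%E.
Proof.
move=> b0 [C HC].
rewrite (esum_generation T
  (fun n => b ^+ n * radial_value N alpha f w n.+1 ^+ 2)).
  apply: (@le_lt_trans _ _ ((f / th) ^+ 2 * C)%:E); last exact: ltry.
  apply: nneseries_le_bound => n.
    by rewrite mulr_ge0 ?exprn_ge0 // mulr_ge0 ?sqr_ge0 // exprn_ge0.
  under eq_bigr do rewrite level_weight.
  by rewrite -mulr_sumr ler_wpM2l ?sqr_ge0.
by move=> n; rewrite mulr_ge0 ?sqr_ge0 // exprn_ge0.
Qed.

Lemma energy_radial (X : J -> R -> R) w t :
    (forall j, X j t = radial w j) ->
  energy X t = (\esum_(j in [set: J]) (radial w j ^+ 2)%:E)%E.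
Proof. by move=> Xw; apply: eq_esum => j _; rewrite Xw. Qed.

Lemma integral_stationary (g : R -> R) (c s t : R) : 0 <= s -> s < t ->
    (forall u, 0 <= u -> g u = c) ->
  (\int[lebesgue_measure]_(u in `[s, t]) (g u)%:E = (c * (t - s))%:E)%E.
Proof.
move=> s0 st gc; rewrite (eq_integral (cst c%:E)); last first.
  move=> u; rewrite inE /= in_itv /= => /andP[su _].
  by rewrite gc // (le_trans s0).
by rewrite integral_cst //= lebesgue_measure_itv /= lte_fin st EFinM EFinB.
Qed.

(** With [b = 2 ^ gamma] the level weight is [viscous_ratio], so the viscous loss is, up to a
    constant, the series of the flux identity. *)
Lemma conservative_in_radial (X : J -> R -> R) w s t : 0 <= s -> s < t ->
    (forall j u, 0 <= u -> X j u = radial w j) ->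
  conservative_in T f nu gamma X s t <->
  (energy X s = energy X s +
     (2 * f ^+ 2 * (radial_value N alpha f w 1%N * (t - s)))%:E -
     (2 * nu)%:E * \sum_(n <oo)
       ((f / th) ^+ 2 * (t - s) *
          (viscous_ratio N alpha gamma ^+ n * w n.+1 ^+ 2))%:E)%E.
Proof.
move=> s0 st Xw; have t0 : 0 <= t by rewrite (le_trans s0) // ltW.
have intX2 j : (\int[lebesgue_measure]_(u in `[s, t]) (X j u ^+ 2)%:E =
    (radial w j ^+ 2 * (t - s))%:E)%E.
  by apply: (integral_stationary (fun u => X j u ^+ 2)) => // u u0; rewrite Xw.
rewrite /conservative_in.
rewrite (energy_radial X w s) ?(energy_radial X w t) => [||j]; last exact: Xw.
  rewrite (integral_stationary _ (radial_value N alpha f w 1%N)) //; last first.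
    by move=> u u0; rewrite Xw // /radial generation_root.
  rewrite -EFinM.
  rewrite [X in ((2 * nu)%:E * X)%E](eq_esum (b := fun j =>
      (dl ^+ generation T j *
        (radial_value N alpha f w (generation T j).+1 ^+ 2 * (t - s)))%:E));
    last first.
    by move=> j _; rewrite intX2 coef_dE.
  rewrite (esum_generation T
    (fun n => dl ^+ n * (radial_value N alpha f w n.+1 ^+ 2 * (t - s)))) =>
    [|n].
    under [X in (_ * X)%E]eq_eseriesr => n _.
      rewrite [dl ^+ n * _]mulrA [N%:R ^+ n * _]mulrA level_weight mulrAC.
      over.
    by [].
  rewrite mulr_ge0 ?exprn_ge0 ?(ltW dl_gt0) // mulr_ge0 ?sqr_ge0 //.
  by rewrite subr_ge0 ltW.
by move=> j; exact: Xw.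
Qed.

End Radial.

(** * The stationary solution *)

Section Main.
Context {R : realType} {N : nat}.
Variables (nu alpha gamma : R).
Hypotheses (N_gt0 : (0 < N)%N) (nu_ge0 : 0 <= nu) (alpha_gt0 : 0 < alpha)
  (gamma_gt0 : 0 < gamma) (alpha_tilde_lt : alpha_tilde R N < alpha).

Let th := theta N alpha.
Let q := viscous_ratio N alpha gamma.
Let e := viscosity_sequence N alpha gamma.
Let th_gt0 : 0 < th. Proof. exact: theta_gt0. Qed.
Let q_gt0 : 0 < q. Proof. exact: viscous_ratio_gt0. Qed.

Section Tree.
Context {J : choiceType}.
Variables (T : regular_tree J N) (f : R).
Hypothesis f_gt0 : 0 < f.

Let ratio_ge0 : 0 <= th / 2 `^ alpha.
Proof. by rewrite divr_ge0 ?powR_ge0 // ltW. Qed.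

Lemma stationary_solution_unique X Y :
    stationary_solution T f nu alpha gamma X ->
    stationary_solution T f nu alpha gamma Y ->
  forall j t, 0 <= t -> Y j t = X j t.
Proof.
move=> Xs Ys j t t0.
have [M [Xb X0 XM]] := stationary_solution_bounded _ _ _ _ _ _ f_gt0 Xs.
have [M' [Yb Y0 YM']] := stationary_solution_bounded _ _ _ _ _ _ f_gt0 Ys.
have [_ _ _ Xst] := Xs; have [_ _ _ Yst] := Ys.
rewrite (Xst j t 0) // (Yst j t 0) //.
apply: (bounded_solution_unique T f nu alpha gamma N_gt0 f_gt0 nu_ge0 alpha_gt0
  gamma_gt0 (Num.max M M') (Y^~ 0) (X^~ 0)).
- by split => // k; rewrite le_max YM' orbT.
- by split => // k; rewrite le_max XM.
Qed.

Lemma radial_stationary_solution w : w 0%N = 1 -> recurrence (e f nu) w ->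
    (forall n, 0 <= w n) ->
    (exists C, forall n,
       \sum_(0 <= i < n) (th / 2 `^ alpha) ^+ i * w i.+1 ^+ 2 <= C) ->
  stationary_solution T f nu alpha gamma (fun j _ => radial T f alpha w j).
Proof.
move=> w0 w_eq w_ge0 wC; apply: balanced_stationary_solution.
- exact: radial_balanced.
- move=> j; rewrite mulr_ge0 // divr_ge0 ?exprn_ge0 // ltW //.
- rewrite (eq_esum (b := fun j =>
      (1 ^+ generation T j * radial T f alpha w j ^+ 2)%:E)); last first.
    by move=> j _; rewrite expr1n mul1r.
  by apply: radial_weight_lty => //; rewrite mul1r.
Qed.

(** The energy is a geometric series of ratio [th / 2 ^ alpha], below 1 as [alpha_tilde < alpha]. *)
Lemma inviscid_solution : nu = 0 ->
  stationary_solution T f nu alpha gamma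
    (fun j _ => radial T f alpha (fun=> 1) j).
Proof.
move=> nu0; apply: radial_stationary_solution => //.
  by move=> n; rewrite /e /viscosity_sequence nu0 !mul0r addr0 expr1n mulr1.
exists (1 - th / 2 `^ alpha)^-1 => n.
have p1 : 0 < 1 - th / 2 `^ alpha by rewrite subr_gt0 theta_ratio_lt1.
rewrite -[leRHS]mul1r ler_pdivlMr //.
suff -> : (\sum_(0 <= i < n) (th / 2 `^ alpha) ^+ i * 1 ^+ 2) *
    (1 - th / 2 `^ alpha) = 1 - (th / 2 `^ alpha) ^+ n.
  by rewrite gerBl exprn_ge0.
elim: n => [|n IHn]; first by rewrite big_geq // mul0r expr0 subrr.
by rewrite big_nat_recr //= mulrDl IHn expr1n [_ ^+ n.+1]exprS; ring.
Qed.

Section Viscous.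
Hypothesis nu_gt0 : 0 < nu.

Let eps := nu / (f * th).
Let eps_gt0 : 0 < eps. Proof. by rewrite divr_gt0 // mulr_gt0. Qed.

(** Since [2 ^ gamma >= 1], the energy weights are at most the powers of [q], and the flux identity
    bounds the sum. *)
Lemma viscous_solution w : w 0%N = 1 -> recurrence (e f nu) w ->
    (forall n, 0 <= w n) ->
  stationary_solution T f nu alpha gamma (fun j _ => radial T f alpha w j).
Proof.
move=> w0 w_eq w_ge0; apply: radial_stationary_solution => //.
exists (w 1%N / eps) => n; rewrite ler_pdivlMr // mulr_suml.
apply: (@le_trans _ _ (\sum_(0 <= i < n) e f nu i * w i.+1 ^+ 2)).
  apply: ler_sum => i _; rewrite mulrC mulrA ler_wpM2r ?sqr_ge0 //.
  rewrite ler_wpM2l ?(ltW eps_gt0) // lerXn2r ?nnegrE ?(ltW q_gt0) //.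
  by rewrite ler_peMl // powR2_ge1 // ltW.
by rewrite (recurrence_flux _ _ _ w0 w_eq) gerBl mulr_ge0 ?sqr_ge0.
Qed.

Section Regular.
Hypothesis le_ag : alpha - alpha_tilde R N <= 3 / 2 * gamma.
Variable w : nat -> R.
Hypotheses (w0 : w 0%N = 1) (w_eq : recurrence (e f nu) w)
  (w_ge0 : forall n, 0 <= w n).

Let q_ge1 : 1 <= q. Proof. exact: viscous_ratio_ge1. Qed.

Lemma radial_regular : regular T (fun j _ => radial T f alpha w j).
Proof.
move=> s t _; rewrite (eq_esum (b := fun j =>
  ((((2 `^ s) ^+ 2) ^+ generation T j) * radial T f alpha w j ^+ 2)%:E)).
  apply: radial_weight_lty; [exact: N_gt0|exact: sqr_ge0|].
  (* Superexponential decay beats the weight, whatever [s] is. *)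
  apply: (supercritical_bound eps q eps_gt0 q_ge1 w w0 w_ge0 w_eq).
  by rewrite mulr_ge0 ?sqr_ge0.
by move=> j _; rewrite exprMn powR2Mn exprAC.
Qed.

Lemma radial_conservative :
  conservative T f nu gamma (fun j _ => radial T f alpha w j).
Proof.
move=> s t s0 st.
apply/(conservative_in_radial T f nu alpha gamma N_gt0 _ w) => //.
(* This factor turns the terms of the flux identity into those of the viscous loss;
   [2 * nu * K * w 1] is then the work of the forcing. *)
pose K := (f / th) ^+ 2 * (t - s) / eps.
rewrite (nneseries_cvg _ (K * w 1%N)); last first.
  have := supercritical_flux_cvg0 eps q eps_gt0 q_ge1 w w0 w_ge0 w_eq.
  move=> /(cvgM (cvg_cst K)); apply: cvg_trans; apply: near_eq_cvg.
  apply: nearW => n; rewrite /= mulr_sumr; apply: eq_bigr => i _.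
  by rewrite /K -/th -/q; field; rewrite !gt_eqF.
rewrite -EFinM.
have -> : 2 * nu * (K * w 1%N) =
    2 * f ^+ 2 * (radial_value N alpha f w 1%N * (t - s)).
  by rewrite /K /eps /radial_value expr1 -/th; field; rewrite !gt_eqF.
by rewrite addeK.
Qed.

End Regular.

Section Dissipative.
Variable w : nat -> R.
Hypotheses (w0 : w 0%N = 1) (w_eq : recurrence (e f nu) w)
  (w_ge : forall n, 1 / 2 <= w n).
Variable X : J -> R -> R.
Hypothesis Xw : forall j t, 0 <= t -> X j t = radial T f alpha w j.

Let w_ge0 n : 0 <= w n.
Proof. by apply: le_trans (w_ge n); rewrite divr_ge0. Qed.

Lemma radial_not_regular : ~ regular T X.
Proof.
(* For [s = alpha] the level weight is [2 ^ alpha * th >= 1], so every generation contributes at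
   least the constant [c] below. *)
move=> /(_ alpha 0 (lexx _)).
rewrite (eq_esum (b := fun j =>
    ((((2 `^ alpha) ^+ 2) ^+ generation T j) *
      radial_value N alpha f w (generation T j).+1 ^+ 2)%:E)); last first.
  by move=> j _; rewrite exprMn powR2Mn exprAC Xw.
rewrite (esum_generation T (fun n =>
    ((2 `^ alpha) ^+ 2) ^+ n * radial_value N alpha f w n.+1 ^+ 2)) => [|n];
  last by rewrite mulr_ge0 ?sqr_ge0 // exprn_ge0 // sqr_ge0.
set S := (X in (X < _)%E) => Sfin.
pose c := (f / th) ^+ 2 * (1 / 4).
have c0 : 0 < c by rewrite mulr_gt0 // exprn_gt0 // divr_gt0.
have Sn n : ((n%:R * c)%:E <= S)%E.
  rewrite /S; apply: le_trans (nneseries_lim_ge n _); last first.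
    move=> k _ _; rewrite lee_fin mulr_ge0 ?exprn_ge0 //.
    by rewrite mulr_ge0 ?sqr_ge0 // exprn_ge0 // sqr_ge0.
  rewrite sumEFin lee_fin mulr_natl -[n in _ *+ n]subn0 -sumr_const_nat.
  apply: ler_sum => i _; rewrite level_weight // -/th ler_wpM2l ?sqr_ge0 //.
  have lth : 1 <= (2 `^ alpha) ^+ 2 * (th / 2 `^ alpha).
    rewrite (_ : _ * _ = 2 `^ alpha * th); last first.
      by field; rewrite gt_eqF // powR_gt0.
    rewrite -[leLHS]mulr1 ler_pM //; first by rewrite powR2_ge1 // ltW.
    exact: theta_ge1.
  have wi : 1 / 4 <= w i.+1 ^+ 2 by have := w_ge i.+1; nra.
  by rewrite -[leLHS]mul1r ler_pM // exprn_ege1.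
have S0 : (0 <= S)%E by have := Sn 0%N; rewrite mul0r.
have Sr : S = (fine S)%:E by rewrite fineK // ge0_fin_numE.
have [n _ /(_ n (leqnn n))] := nbhs_infty_ger (fine S / c + 1).
have := Sn n; rewrite Sr lee_fin -lerBrDr ler_pdivrMr // mulrBl mul1r.
lra.
Qed.

(** The flux never falls below [1/4 * 1/2], so viscosity accounts for at most [w 1 - 1/8] of the
    input [w 1]. *)
Lemma radial_anomalous_dissipation :
  stationary_solution T f nu alpha gamma X ->
  anomalous_dissipation T f nu gamma X.
Proof.
move=> Xs s t s0 st.
move=> /(conservative_in_radial T f nu alpha gamma N_gt0 _ w _ _ s0 st Xw).
have [_ Xsum _ _] := Xs.
(* Finiteness lets the energy be cancelled from the balance. *)
have Efin : energy X s \is a fin_num.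
  rewrite ge0_fin_numE ?Xsum //.
  by apply: esum_ge0 => k _; rewrite lee_fin sqr_ge0.
pose K := (f / th) ^+ 2 * (t - s) / eps.
have K_gt0 : 0 < K.
  by rewrite divr_gt0 // mulr_gt0 ?subr_gt0 // exprn_gt0 // divr_gt0.
have term_ge0 n : 0 <= (f / th) ^+ 2 * (t - s) * (q ^+ n * w n.+1 ^+ 2).
  have ts : 0 <= t - s by rewrite subr_ge0 ltW.
  have qn : 0 <= q ^+ n by rewrite exprn_ge0 // ltW.
  by apply: mulr_ge0; apply: mulr_ge0 => //; exact: sqr_ge0.
have : (\sum_(n <oo) ((f / th) ^+ 2 * (t - s) * (q ^+ n * w n.+1 ^+ 2))%:E
    <= (K * (w 1%N - 1 / 8))%:E)%E.
  apply: nneseries_le_bound => // n.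
  rewrite (eq_bigr (fun i => K * (e f nu i * w i.+1 ^+ 2))); last first.
    move=> i _; rewrite /K /e /viscosity_sequence -/th -/q -/eps.
    by field; rewrite !gt_eqF.
  rewrite -mulr_sumr ler_wpM2l ?(ltW K_gt0) //.
  rewrite (recurrence_flux _ _ _ w0 w_eq) lerD2l lerN2.
  have wn := w_ge n; have wn1 := w_ge n.+1.
  have w2 : 1 / 4 <= w n ^+ 2 by nra.
  rewrite (_ : 1 / 8 = 1 / 4 * (1 / 2)); last by field.
  by rewrite ler_pM.
have : (0 <= \sum_(n <oo)
    ((f / th) ^+ 2 * (t - s) * (q ^+ n * w n.+1 ^+ 2))%:E)%E.
  by apply: nneseries_ge0 => n _ _; rewrite lee_fin.
case: (\sum_(n <oo) _)%E => [r|//|//] _; rewrite lee_fin => rK.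
rewrite -(fineK Efin) -EFinM -EFinN -!EFinD => -[].
have -> : 2 * f ^+ 2 * (radial_value N alpha f w 1%N * (t - s)) =
    2 * nu * (K * w 1%N).
  by rewrite /K /eps /radial_value expr1 -/th; field; rewrite !gt_eqF.
move=> E_eq; have : 2 * nu * (K * w 1%N - r) = 0 by rewrite mulrBr; lra.
apply/eqP; rewrite gt_eqF // !mulr_gt0 //; move: rK K_gt0; nra.
Qed.

End Dissipative.
End Viscous.
End Tree.
End Main.

Theorem theorem2p3 (R : realType) (N : nat) (N_ge1 : (1 <= N)%N)
    (nu alpha gamma : R) (nu_ge0 : 0 <= nu) (alpha_gt0 : 0 < alpha)
    (gamma_gt0 : 0 < gamma) (alpha_tilde_lt : alpha_tilde R N < alpha) :
  (forall (J : choiceType) (T : regular_tree J N) (f : R), 0 < f ->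
     exists X : J -> R -> R,
       [/\ stationary_solution T f nu alpha gamma X,
           (forall Y, stationary_solution T f nu alpha gamma Y ->
              forall j t, 0 <= t -> Y j t = X j t),
           (nu = 0 -> forall j t, 0 <= t ->
              X j t = f * 2 `^ (- ((generation T j).+1%:R / 3
                                   * (2 * alpha_tilde R N + alpha)))) &
           (0 < nu -> 0 < alpha - alpha_tilde R N <= 3 / 2 * gamma ->
              conservative T f nu gamma X /\ regular T X)]) /\
  (0 < nu -> 3 / 2 * gamma < alpha - alpha_tilde R N ->
     exists2 C : R, 0 < C &
       forall (J : choiceType) (T : regular_tree J N) (f : R), C < f ->
       forall X, stationary_solution T f nu alpha gamma X ->
         ~ regular T X /\ anomalous_dissipation T f nu gamma X).
Proof.
split=> [J T f f_gt0|nu_gt0 ag_gt].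
  have uniq X : stationary_solution T f nu alpha gamma X ->
      forall Y, stationary_solution T f nu alpha gamma Y ->
        forall j t, 0 <= t -> Y j t = X j t.
    move=> Xs Y Ys; exact: (stationary_solution_unique nu alpha gamma N_ge1
      nu_ge0 alpha_gt0 gamma_gt0 T f f_gt0 X Y Xs Ys).
  have [nu0|nu_neq0] := eqVneq nu 0.
    have Xs := inviscid_solution nu alpha gamma N_ge1 alpha_tilde_lt T f f_gt0
      nu0.
    exists (fun j _ => radial T f alpha (fun=> 1) j); split=> //.
    - exact: uniq.
    - move=> _ j t _; rewrite /radial /radial_value mulr1 /theta; congr (_ * _).
      by rewrite powRN; congr (_^-1); rewrite -powR2Mn; congr (_ `^ _); field.
    - by rewrite nu0 ltxx.
  have nu_gt0 : 0 < nu by rewrite lt_neqAle eq_sym nu_neq0.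
  have eps_gt0 : 0 < nu / (f * theta N alpha).
    by rewrite divr_gt0 // mulr_gt0 // theta_gt0.
  have [w [w0 w_eq w_ge0]] := geometric_solution_exists _ _ eps_gt0
    (viscous_ratio_gt0 N alpha gamma).
  have Xs : stationary_solution T f nu alpha gamma
      (fun j _ => radial T f alpha w j).
    exact: viscous_solution.
  exists (fun j _ => radial T f alpha w j); split=> //.
  - exact: uniq.
  - by move=> nu0; rewrite nu0 eqxx in nu_neq0.
  - move=> _ /andP[_ le_ag]; split.
      exact: (radial_conservative nu).
    exact: (radial_regular nu alpha gamma).
have q_lt1 := viscous_ratio_lt1 N alpha gamma ag_gt.
have th_gt0 := theta_gt0 N alpha.
have q1_gt0 : 0 < 1 - viscous_ratio N alpha gamma by rewrite subr_gt0.
(* The forcing at which [eps = 1 - q]; any larger one gives a smaller [eps]. *)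
exists (nu / (theta N alpha * (1 - viscous_ratio N alpha gamma))).
  by rewrite divr_gt0 // mulr_gt0.
move=> J T f Cf X Xs.
have f_gt0 : 0 < f by apply: lt_trans Cf; rewrite divr_gt0 // mulr_gt0.
have eps_gt0 : 0 < nu / (f * theta N alpha) by rewrite divr_gt0 // mulr_gt0.
have eps_le : nu / (f * theta N alpha) <= 1 - viscous_ratio N alpha gamma.
  rewrite ler_pdivrMr ?mulr_gt0 // mulrCA [_ * theta _ _]mulrC.
  by rewrite -ler_pdivrMr ?mulr_gt0 // ltW.
have [w [w0 w_eq w_ge]] := geometric_solution_ge_half _ _ eps_gt0
  (viscous_ratio_gt0 N alpha gamma) q_lt1 eps_le.
have w_ge0 n : 0 <= w n by apply: le_trans (w_ge n); rewrite divr_ge0.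
have ws : stationary_solution T f nu alpha gamma
    (fun j _ => radial T f alpha w j) by exact: viscous_solution.
(* By uniqueness, an arbitrary stationary solution inherits the lower bound of the constructed
   one. *)
have Xw j t : 0 <= t -> X j t = radial T f alpha w j.
  by move=> t0; rewrite (stationary_solution_unique nu alpha gamma N_ge1 nu_ge0
    alpha_gt0 gamma_gt0 T f f_gt0 _ X ws Xs).
split; first exact: (radial_not_regular alpha N_ge1 alpha_gt0 T f f_gt0 w).
exact: (radial_anomalous_dissipation nu alpha gamma N_ge1 T f f_gt0 nu_gt0 w).
Qed.
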